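(* Let $H$ be a Hilbert space and consider the evolution problem $$\dot u=A(t)u+F(t,u)+b(t),\qquad u(0)=u_0,$$ where $u(t)$ is a function with values in $H$, $b(t)\in H$, $A(t)$ is for each $t\ge 0$ a bounded linear operator in $H$ satisfying $$\mathrm{Re}(A(t)u,u)\le-\gamma(t)\|u\|^2\quad\forall u\in H,\ t\ge0,\qquad \gamma(t)=\frac{r}{(1+t)^{\nu}},$$ with constants $r>0$ and $\nu$, and $F(t,u)$ is a nonlinear map in $H$. Assume that $$\|F(t,u)\|\le\alpha(t,\|u\|),\qquad\|b(t)\|\le\beta(t),$$ where $\beta:\mathbb{R}_+\to[0,\infty)$ is continuous, and $\alpha:\mathbb{R}_+\times\mathbb{R}_+\to[0,\infty)$ is continuous, nondecreasing with respect to its second argument, and locally Lipschitz with respect to its second argument (for all $T<\infty$, $M>0$ there is a constant $L(T,M)>0$ with $|\alpha(t,g)-\alpha(t,h)|\le L(T,M)|g-h|$ whenever $t\in[0,T]$, $|g|\le M$, $|h|\le M$). Assume moreover that $$\alpha(t,g)\le c_0g^p,\quad p>1;\qquad\beta(t)\le\frac{c_1}{(1+t)^\omega},$$ where $c_0,p,\omega,c_1$ are positive constants. Let $\lambda>0$ and $q>0$ be constants such that $$q(p-1)\ge\nu,\qquad\omega-q\ge\nu,\qquad1\ge\nu,$$ $$\frac{c_0}{\lambda^{p-1}}+c_1\lambda+q\le r,$$ and $$\|u_0\|<\frac1\lambda.$$ Then the solution $u(t)$ to the evolution problem exists on all of $\mathbb{R}_+$ and satisfies $$0\le\|u(t)\|\le\frac1{\lambda(1+t)^q}\qquad\forall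 t\ge0.$$
   Context: $\mathbb{R}_+:=[0,\infty)$; $(\cdot,\cdot)$ and $\|\cdot\|$ denote the inner product and norm of $H$; $\dot u=du/dt$.
   Formalization: Existence on all of R_+ is proved assuming that A(t)u+F(t,u)+b(t) is jointly continuous in (t,u) and that the problem has a local solution through every initial datum; without regularity in t and u existence can fail. The bound holds for every solution without this. *)

(* Defs.v *)
From HB Require Import structures.
From mathcomp Require Import all_boot all_order all_algebra.
From mathcomp Require Import sesquilinear.
From mathcomp Require Import complex.
From mathcomp Require Import all_classical all_reals all_analysis.

Set Implicit Arguments.
Unset Strict Implicit.
Unset Printing Implicit Defensive.

Import Order.TTheory GRing.Theory Num.Theory.
Import numFieldNormedType.Exports.

Local Open Scope classical_set_scope.
Local Open Scope ring_scope.

(* The Hilbert space may be real or complex: [scalar_field R k] is R or R[i],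
   while time, norms and the comparison functions always live in R. *)
Variant scalar_kind : Set := RealScalars | ComplexScalars.

Definition scalar_field (R : realType) (k : scalar_kind) : numFieldType :=
  match k with RealScalars => R | ComplexScalars => R[i] end.

Definition of_real (R : realType) (k : scalar_kind) : R -> scalar_field R k :=
  match k return R -> scalar_field R k with
  | RealScalars => fun x => x
  | ComplexScalars => fun x => (x%:C)%C
  end.

Definition re (R : realType) (k : scalar_kind) : scalar_field R k -> R :=
  match k return scalar_field R k -> R with
  | RealScalars => fun x => x
  | ComplexScalars => fun z => complex.Re z
  end.

Definition scalar_conj (R : realType) (k : scalar_kind) :
    scalar_field R k -> scalar_field R k :=
  match k return scalar_field R k -> scalar_field R k with
  | RealScalars => fun x => x
  | ComplexScalars => fun z => (z^*)%C
  end.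

Section Evolution.
Variables (R : realType) (k : scalar_kind).
Variable H : completeNormedModType (scalar_field R k).

(* The library norm of H takes its values in the scalar field. *)
Definition rnorm (u : H) : R := re `|u|.

(* Makes the complete normed space H a Hilbert space: {dot _ for _} provides a
   positive definite form, linear on the left and conjugate-linear on the
   right, but does not relate it to the norm of H. *)
Definition induces_norm (dot : {dot H for @scalar_conj R k}) : Prop :=
  forall u : H, dot u u = `|u| ^+ 2.

Definition bounded_operator (B : {linear H -> H}) : Prop :=
  exists M : R, forall u, rnorm (B u) <= M * rnorm u.

Definition rhs (A : R -> {linear H -> H}) (F : R -> H -> H) (b : R -> H)
    (t : R) (u : H) : H := A t u + F t u + b t.

(* u is a classical solution of u' = f(t,u), u(t0) = v on [t0, T), T <= +oo.
  The derivative is two-sided for t > t0 and one-sided at t0; the values of u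
   outside [t0, T) are irrelevant. *)
Definition solution_on (f : R -> H -> H) (t0 : R) (T : \bar R) (v : H)
    (u : R -> H) : Prop :=
  u t0 = v /\
  forall t : R, t0 <= t -> (t%:E < T)%E ->
    (fun h : R => (of_real k h)^-1 *: (u (t + h) - u t))
      @ within [set h | t0 <= t + h] (0 : R)^' --> f t (u t).

(* Local solvability of the initial value problem from every initial datum, with
   a right-hand side that is jointly continuous. The existence of local
   solutions does not follow from continuity when H is infinite-dimensional; it
   does when f is moreover locally Lipschitz in its second argument. Uniqueness
   is not required. *)
Definition locally_solvable (f : R -> H -> H) : Prop :=
  {within [set x : R * H | 0 <= x.1], continuous (fun x => f x.1 x.2)} /\
  forall (t0 : R) (v : H), 0 <= t0 ->
    exists T : R, t0 < T /\ exists u : R -> H, solution_on f t0 T%:E v u.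

End Evolution.

Definition gamma (R : realType) (r nu t : R) : R := r / (1 + t) `^ nu.

Section ComparisonData.
Variable R : realType.

(* The functions alpha and beta are only constrained on nonnegative arguments. *)
Definition admissible_alpha (alpha : R -> R -> R) : Prop :=
  [/\ forall t g, 0 <= t -> 0 <= g -> 0 <= alpha t g,
      {within [set x : R * R | 0 <= x.1 /\ 0 <= x.2],
        continuous (fun x => alpha x.1 x.2)},
      forall t g h, 0 <= t -> 0 <= g -> g <= h -> alpha t g <= alpha t h &
      forall T M, 0 < M -> exists L, 0 < L /\
        forall t g h, 0 <= t <= T -> 0 <= g <= M -> 0 <= h <= M ->
          `|alpha t g - alpha t h| <= L * `|g - h| ].

Definition admissible_beta (beta : R -> R) : Prop :=
  (forall t, 0 <= t -> 0 <= beta t) /\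
  {within [set t : R | 0 <= t], continuous beta}.

End ComparisonData.

(* Main.v *)
Require Import Defs.
From HB Require Import structures.
From mathcomp Require Import all_boot all_order all_algebra.
From mathcomp Require Import sesquilinear complex.
From mathcomp Require Import all_classical all_reals all_analysis.
From mathcomp Require Import lra ring.

(** Write g(t) for the norm of u(t). Pairing the equation with u(t) and using
    dissipativity gives g' <= - gamma g + alpha(t, g) + beta(t) wherever g > 0.
    The function phi(t) = 1 / (lambda (1 + t)^q) is a supersolution of this
    scalar inequality: after division by (1 + t)^(- q - nu) / lambda, the three
    exponent conditions reduce the claim to
    c0 / lambda^(p - 1) + c1 lambda + q <= r ([supersolution]). Since alpha is
    locally Lipschitz in g, the positive part of g - phi obeys a Gronwall
    inequality on every compact interval, and it starts from zero; hence
    g <= phi as long as u exists ([rnorm_le_supersolution],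
    [solution_bound]).

    For global existence, suppose that u solves the problem on [0, T) with T
    finite. The operators A(t) are bounded for each t separately, with no
    uniformity in t assumed. Joint continuity of the right-hand side at (T, 0)
    supplies it: the right-hand side is bounded on a small ball for t near T, so
    is A(t), because F and b are controlled by c0 |u|^p and c1, and linearity
    carries the bound to balls of any radius ([rhs_locally_bounded]). As u is
    bounded by 1 / lambda, its derivative is bounded near T, u is Lipschitz
    there, and it has a limit v at T by completeness ([left_limit]). A local
    solution started at (T, v) then continues u; the two-sided derivative at T
    exists because u'(t) tends to f(T, v) as t tends to T from the left
    ([glue_solutions]). Solutions ordered by extension admit
    upper bounds of chains, so a maximal one exists, and by the previous step
    its lifetime is infinite ([solution_global]).

    Real and complex scalars are treated together by viewing H as a real Hilbert
    space for the norm [rnorm] and the inner product Re (u, v), and derivatives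
    of curves are handled through the first-order expansion [has_deriv]. *)

Set Implicit Arguments.
Unset Strict Implicit.
Unset Printing Implicit Defensive.
Import Order.TTheory GRing.Theory Num.Theory.
Import numFieldNormedType.Exports.

Local Open Scope classical_set_scope.
Local Open Scope ring_scope.

(** * The underlying real Hilbert space *)

Section Scalars.
Variables (R : realType) (k : scalar_kind).
Implicit Types (x y : R) (z w : scalar_field R k).

Lemma of_real_is_zmod_morphism : zmod_morphism (@of_real R k).
Proof. by case: k => x y //=; rewrite rmorphB. Qed.

Lemma of_real_is_monoid_morphism : monoid_morphism (@of_real R k).
Proof. by case: k; split => //= x y; rewrite rmorphM. Qed.

HB.instance Definition _ := GRing.isZmodMorphism.Build R (scalar_field R k)
  (@of_real R k) of_real_is_zmod_morphism.
HB.instance Definition _ := GRing.isMonoidMorphism.Build R (scalar_field R k)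
  (@of_real R k) of_real_is_monoid_morphism.

Lemma of_real0 : of_real k (0 : R) = 0.
Proof. exact: rmorph0. Qed.

Lemma of_realD x y : of_real k (x + y) = of_real k x + of_real k y.
Proof. exact: rmorphD. Qed.

Lemma of_real1 : of_real k (1 : R) = 1.
Proof. exact: rmorph1. Qed.

Lemma of_realM x y : of_real k (x * y) = of_real k x * of_real k y.
Proof. exact: rmorphM. Qed.

Lemma of_realN x : of_real k (- x) = - of_real k x.
Proof. exact: rmorphN. Qed.

Lemma of_realX x n : of_real k (x ^+ n) = of_real k x ^+ n.
Proof. exact: rmorphXn. Qed.

Lemma re_of_real x : re (of_real k x) = x.
Proof. by case: k. Qed.

Lemma re_is_zmod_morphism : zmod_morphism (@re R k).
Proof. by case: k => //= -[a b] [c d]. Qed.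

HB.instance Definition _ := GRing.isZmodMorphism.Build (scalar_field R k) R
  (@re R k) re_is_zmod_morphism.

Lemma re_of_realM x z : re (of_real k x * z) = x * re z.
Proof. by case: k z => //= -[a b] /=; rewrite mul0r subr0. Qed.

Lemma re_conj z : re (scalar_conj z) = re z.
Proof. by case: k z => //= -[]. Qed.

Lemma ge0_of_real z : 0 <= z -> z = of_real k (re z).
Proof.
by case: k z => //= -[a b]; rewrite lecE /= => /andP[/eqP-> _].
Qed.

Lemma ltr_of_real x y : (of_real k x < of_real k y) = (x < y).
Proof. by case: k => //=; rewrite ltcR. Qed.

Lemma ler_of_real x y : (of_real k x <= of_real k y) = (x <= y).
Proof. by case: k => //=; rewrite lecR. Qed.

Lemma norm_of_real x : `|of_real k x| = of_real k `|x|.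
Proof. by case: k => //=; rewrite normc_def /= expr0n /= addr0 sqrtr_sqr. Qed.

End Scalars.

Local Notation "x *r: u" := (of_real _ x *: u) (at level 40).

Section RealNorm.
Variables (R : realType) (k : scalar_kind).
Variable H : completeNormedModType (scalar_field R k).
Implicit Types (x y : R) (u v w : H).

Lemma norm_of_rnorm u : `|u| = of_real k (rnorm u).
Proof. exact: ge0_of_real. Qed.

Lemma rnorm_ge0 u : 0 <= rnorm u.
Proof. by rewrite -(ler_of_real k) of_real0 -norm_of_rnorm. Qed.

Lemma rnormD u v : rnorm (u + v) <= rnorm u + rnorm v.
Proof. by rewrite -(ler_of_real k) of_realD -!norm_of_rnorm; exact: ler_normD. Qed.

Lemma rnormN u : rnorm (- u) = rnorm u.
Proof. by rewrite /rnorm normrN. Qed.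

Lemma rdistC u v : rnorm (u - v) = rnorm (v - u).
Proof. by rewrite -opprB rnormN. Qed.

Lemma rnorm_dist u v : `|rnorm u - rnorm v| <= rnorm (u - v).
Proof.
rewrite ler_norml lerNl opprB !lerBlDr; apply/andP; split.
  by have := rnormD (v - u) u; rewrite subrK (rdistC u).
by have := rnormD (u - v) v; rewrite subrK.
Qed.

Lemma rnorm0 : rnorm (0 : H) = 0.
Proof. by rewrite /rnorm normr0 raddf0. Qed.

Lemma rnorm_eq0 u : rnorm u = 0 -> u = 0.
Proof. by move=> e; apply: normr0_eq0; rewrite norm_of_rnorm e of_real0. Qed.

Lemma rnormZ x u : rnorm (x *r: u) = `|x| * rnorm u.
Proof. by rewrite /rnorm normrZ norm_of_real re_of_realM. Qed.

Lemma lt_dist_rnorm u v e : (`|u - v| < of_real k e) = (rnorm (u - v) < e).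
Proof. by rewrite norm_of_rnorm ltr_of_real. Qed.

(** Norms take values in the scalar field; this trades its positive elements
    for positive reals in the definition of a limit. *)
Lemma cvg_rnormP {T : Type} {F : set_system T} {FF : Filter F} (f : T -> H) l :
  f @ F --> l <-> forall e : R, 0 < e -> \forall t \near F, rnorm (f t - l) < e.
Proof.
split=> [/cvgrPdist_lt fl e e0|fl].
  have : 0 < of_real k e by rewrite -(of_real0 R k) ltr_of_real.
  by move=> /fl; apply: filterS => t; rewrite lt_dist_rnorm rdistC.
apply/cvgrPdist_lt => e e0; rewrite (ge0_of_real (ltW e0)).
have /fl : 0 < re e.
  by rewrite -(ltr_of_real k) of_real0 -(ge0_of_real (ltW e0)).
by apply: filterS => t; rewrite lt_dist_rnorm rdistC.
Qed.

End RealNorm.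

Section RealInner.
Variables (R : realType) (k : scalar_kind).
Variable H : completeNormedModType (scalar_field R k).
Variable dot : {dot H for @scalar_conj R k}.
Implicit Types (x y : R) (u v w : H).

(** For complex scalars this is the real part of the sesquilinear form, which is a
    real inner product inducing the same norm. *)
Definition inner u v : R := re (dot u v).

Lemma innerBl v u w : inner (u - w) v = inner u v - inner w v.
Proof. by rewrite /inner linearBl raddfB. Qed.

Lemma innerDl v u w : inner (u + w) v = inner u v + inner w v.
Proof. by rewrite /inner linearDl raddfD. Qed.

Lemma innerNl v u : inner (- u) v = - inner u v.
Proof. by rewrite /inner linearNl raddfN. Qed.

Lemma innerC u v : inner u v = inner v u.
Proof. by rewrite /inner (hermitian_subproof u v) expr0 mul1r re_conj. Qed.

Lemma innerBr v u w : inner v (u - w) = inner v u - inner v w.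
Proof. by rewrite ![inner v _]innerC innerBl. Qed.

Lemma innerDr v u w : inner v (u + w) = inner v u + inner v w.
Proof. by rewrite ![inner v _]innerC innerDl. Qed.

Lemma innerZl x u v : inner (x *r: u) v = x * inner u v.
Proof. by rewrite /inner linearZl_LR /= re_of_realM. Qed.

Lemma innerZr x u v : inner u (x *r: v) = x * inner u v.
Proof. by rewrite innerC innerZl innerC. Qed.

Hypothesis hH : induces_norm dot.

Lemma inner_rnorm u : inner u u = rnorm u ^+ 2.
Proof. by rewrite /inner hH norm_of_rnorm -of_realX re_of_real. Qed.

(** Cauchy-Schwarz, read off from the square of | |v| u - |u| v | being
    nonnegative; the degenerate cases have to be set aside since one divides
    by |u| |v|. *)
Lemma inner_le u v : inner u v <= rnorm u * rnorm v.
Proof.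
have [v0|v0] := eqVneq (rnorm v) 0.
  rewrite v0 mulr0 (rnorm_eq0 v0).
  by rewrite -[X in inner _ X](scale0r (0 : H)) -(of_real0 R k) innerZr mul0r.
have [u0|u0] := eqVneq (rnorm u) 0.
  rewrite u0 mul0r (rnorm_eq0 u0).
  by rewrite -[X in inner X _](scale0r (0 : H)) -(of_real0 R k) innerZl mul0r.
have up : 0 < rnorm u by rewrite lt_neqAle eq_sym u0 rnorm_ge0.
have vp : 0 < rnorm v by rewrite lt_neqAle eq_sym v0 rnorm_ge0.
have := sqr_ge0 (rnorm (rnorm v *r: u - rnorm u *r: v)).
rewrite -inner_rnorm innerBl !innerBr !innerZl !innerZr !inner_rnorm (innerC v).
have -> : rnorm v * (rnorm v * rnorm u ^+ 2) - rnorm v * (rnorm u * inner u v) -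
   (rnorm u * (rnorm v * inner u v) - rnorm u * (rnorm u * rnorm v ^+ 2)) =
   (2 * (rnorm u * rnorm v)) * (rnorm u * rnorm v - inner u v) by ring.
by rewrite pmulr_rge0 ?subr_ge0// !mulr_gt0.
Qed.

Lemma normr_inner_le u v : `|inner u v| <= rnorm u * rnorm v.
Proof.
rewrite ler_norml inner_le andbT lerNl.
by rewrite -innerNl -(rnormN u) inner_le.
Qed.

End RealInner.

(** * Scalar calculus and a one-sided Gronwall lemma *)

Section RealCalculus.
Variable R : realType.
Implicit Types (f : R -> R) (a b t d : R).

Lemma within_continuous_dist f a b :
  (forall t, a <= t <= b -> forall e, 0 < e -> exists2 del, 0 < del &
     forall s, a <= s <= b -> `|s - t| < del -> `|f s - f t| < e) ->
  {within `[a, b], continuous f}.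
Proof.
move=> cf; apply/subspace_continuousP => t /=; rewrite in_itv/= => tab.
apply/cvgrPdist_lt => e e0; have [del del0 fdel] := cf _ tab _ e0.
apply/nbhs_ballP; exists del => //= s; rewrite /ball/= => st.
by rewrite in_itv/= => sab; rewrite distrC fdel// distrC.
Qed.

Lemma is_derive_dist f t d :
  (forall e, 0 < e -> exists2 del, 0 < del & forall s, `|s - t| < del ->
     `|f s - f t - (s - t) * d| <= e * `|s - t|) ->
  is_derive t (1 : R) f d.
Proof.
move=> df.
have cvd : (h^-1 *: (f (h *: 1 + t) - f t)) @[h --> (0:R)^'] --> d.
  apply/cvgrPdist_le => e e0; have [del del0 fdel] := df _ e0.
  apply/nbhs_ballP; exists del => //= h; rewrite /ball/= sub0r normrN => hdel h0.
  have := fdel (h + t); rewrite addrK => /(_ hdel).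
  rewrite [h *: 1]mulr1 [_ *: _]mulrC.
  rewrite distrC => hle; rewrite -(ler_pM2r (_ : 0 < `|h|)) ?normr_gt0//.
  by rewrite -normrM mulrBl divfK// (mulrC d).
split; last exact/cvg_lim.
by apply/cvg_ex; exists d.
Qed.

(** The differential inequality is asked only where f > 0, so that f may be the
    norm of a curve minus a nonnegative function: where f > 0 the norm is
    positive, hence differentiable. If f b > 0, let s be the last point of
    [a, b] with f s <= 0. On ]s, b] the inequality holds, so exp(- K t) f t is
    nonincreasing on [s, b], contradicting f s <= 0 < f b. *)
Lemma le0_of_derive_le f df a b K : a <= b ->
  {within `[a, b], continuous f} -> f a <= 0 ->
  (forall t, a < t < b -> 0 < f t ->
     is_derive t (1 : R) f (df t) /\ df t <= K * f t) ->
  f b <= 0.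
Proof.
move=> ab cf fa fd; rewrite leNgt; apply/negP => fb.
pose E := [set t | a <= t <= b /\ f t <= 0].
have supE : has_sup E.
  by split; [exists a; split; rewrite ?lexx| exists b => t [/andP[]]].
pose s := sup E.
have as_ : a <= s by apply: ub_le_sup; [exact: supE.2|split; rewrite ?lexx].
have sb : s <= b by apply: ge_sup; [exact: supE.1|move=> t [/andP[]]].
have fpos t : s < t -> t <= b -> 0 < f t.
  move=> st tb; rewrite ltNge; apply/negP => ft.
  have : t <= s.
    by apply: ub_le_sup; [exact: supE.2|split => //; rewrite tb (le_trans as_ (ltW st))].
  by rewrite leNgt st.
have /subspace_continuousP cf' := cf.
(* Otherwise f > 0 near s, while s is a limit of points of E. *)
have fs : f s <= 0.
  rewrite leNgt; apply/negP => fs.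
  have sab : `[a, b]%classic s by rewrite /= in_itv/= as_ sb.
  have /cvgrPdist_lt/(_ _ fs) := cf' s sab.
  rewrite near_withinE => /nbhs_ballP[e /= e0 fe].
  have [t [/andP[at_ tb] ft] st] := sup_adherent e0 supE.
  have ts : t <= s by apply: ub_le_sup; [exact: supE.2|split => //; rewrite at_].
  have := fe t; rewrite /ball/= ger0_norm ?subr_ge0// in_itv/= at_ tb.
  rewrite ltrBlDr -ltrBlDl => /(_ st isT).
  by rewrite ltNge => /negP; apply; rewrite ler_normr lerBrDr gerDl ft.
pose g t := expR (- K * t) * f t.
have gd t : s < t < b -> is_derive t (1 : R) g (expR (- K * t) * (df t - K * f t)).
  move=> /andP[st tb].
  have [|fdt _] := fd t _ (fpos _ st (ltW tb)); first by rewrite tb (le_lt_trans as_).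
  rewrite /g; apply: is_derive_eq.
  by rewrite /GRing.scale/=; ring.
have cg : {within `[s, b], continuous g}.
  apply/subspace_continuousP => x /=; rewrite in_itv/= => /andP[sx xb].
  apply: cvgM.
    apply: cvg_within_filter; apply: continuous_comp; last exact: continuous_expR.
    by apply: cvgMr; exact: cvg_id.
  have xab : `[a, b]%classic x by rewrite /= in_itv/= xb (le_trans as_).
  apply: cvg_trans (cf' x xab); apply: cvg_app; apply: within_subset => // y /=.
  by rewrite !in_itv/= => /andP[sy ->]; rewrite (le_trans as_ sy).
have : g b <= g s.
  apply: (@ler0_derive1_le_cc _ g s b) => //; rewrite ?in_itv/= ?lexx ?sb//.
    by move=> x; rewrite in_itv/= => /gd[].
  move=> x; rewrite in_itv/= => xsb; rewrite derive1E; have [_ ->] := gd _ xsb.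
  case/andP: xsb => sx xb.
  have [|_ dfle] := fd x _ (fpos _ sx (ltW xb)); first by rewrite xb (le_lt_trans as_).
  by rewrite pmulr_rle0 ?expR_gt0// subr_le0.
apply/negP; rewrite -ltNge (@le_lt_trans _ _ 0)//.
  by rewrite pmulr_rle0 ?expR_gt0.
by rewrite mulr_gt0 ?expR_gt0.
Qed.

End RealCalculus.

(** * Curves in the Hilbert space *)

Section Curves.
Variables (R : realType) (k : scalar_kind).
Variable H : completeNormedModType (scalar_field R k).
Implicit Types (S : set R) (u w : R -> H) (a b t e : R) (d v : H).

(** First-order expansion of u at t along S, with the weak inequality so that
    s = t is allowed. Taking S = [t0, +oo) covers the two-sided derivative at
    interior points and the one-sided derivative at t0 alike. *)
Definition has_deriv S u t d := forall e, 0 < e ->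
  exists2 del, 0 < del & forall s, S s -> `|s - t| < del ->
    rnorm (u s - u t - (s - t) *r: d) <= e * `|s - t|.

Definition cont_at S u t := forall e, 0 < e ->
  exists2 del, 0 < del & forall s, S s -> `|s - t| < del ->
    rnorm (u s - u t) < e.

(** The derivative is a local notion: it can be transported to another curve and
    another set which look the same near t. *)
Lemma has_deriv_near S S' u u' t d del : 0 < del -> u' t = u t ->
  (forall s, S' s -> `|s - t| < del -> S s /\ u' s = u s) ->
  has_deriv S u t d -> has_deriv S' u' t d.
Proof.
move=> del0 ut uS ud e /ud[del1 del10 ud1].
exists (Num.min del del1) => [|s S's]; first by rewrite lt_min del0.
rewrite lt_min => /andP[sd sd1]; have [Ss ->] := uS _ S's sd.
by rewrite ut ud1.
Qed.

Lemma has_deriv_interior a u t d : a < t ->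
  has_deriv [set s | a <= s] u t d -> has_deriv setT u t d.
Proof.
rewrite -subr_gt0 => at_; apply: has_deriv_near at_ erefl _ => s _ /=.
by rewrite ltr_norml => /andP[+ _]; rewrite opprB ltrD2r => /ltW.
Qed.

Lemma has_deriv_lipschitz S u t d : has_deriv S u t d ->
  exists2 del, 0 < del & forall s, S s -> `|s - t| < del ->
    rnorm (u s - u t) <= (1 + rnorm d) * `|s - t|.
Proof.
move=> /(_ _ ltr01)[del del0 ud]; exists del => // s Ss sd.
rewrite -[u s - u t](subrK ((s - t) *r: d)) (le_trans (rnormD _ _))//.
by rewrite mulrDl (mulrC (rnorm d)) -rnormZ lerD2r ud.
Qed.

Lemma has_deriv_cont S u t d : has_deriv S u t d -> cont_at S u t.
Proof.
move=> /has_deriv_lipschitz[del del0 ud] e e0.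
have d0 : 0 < 1 + rnorm d by rewrite ltr_pwDl// rnorm_ge0.
exists (Num.min del (e / (1 + rnorm d))) => [|s Ss].
  by rewrite lt_min del0 divr_gt0.
rewrite lt_min => /andP[sd]; rewrite ltr_pdivlMr// mulrC.
by apply: le_lt_trans; exact: ud.
Qed.

Lemma cont_at_sub S S' u t : S' `<=` S -> cont_at S u t -> cont_at S' u t.
Proof. by move=> SS uc e /uc[del d0 ud]; exists del => // s /SS; exact: ud. Qed.

(** Trades a limit over punctured one-sided neighbourhoods for an inequality which
    can be fed to norm estimates; halving e recovers the strict inequality of the
    limit. *)
Lemma diff_quotient_cvgP t0 u t d :
  (fun h : R => (of_real k h)^-1 *: (u (t + h) - u t))
      @ within [set h | t0 <= t + h] (0 : R)^' --> d <->
  has_deriv [set s | t0 <= s] u t d.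
Proof.
have quot h : h != 0 -> rnorm ((of_real k h)^-1 *: (u (t + h) - u t) - d) =
    rnorm (u (t + h) - u t - h *r: d) / `|h|.
  move=> h0; rewrite mulrC -normfV -rnormZ [in RHS]scalerBr [in RHS]scalerA.
  have -> : (of_real k h)^-1 = of_real k h^-1 by rewrite (fmorphV (@of_real R k)).
  by rewrite -of_realM mulVf// of_real1 scale1r.
split=> [/cvg_rnormP ud e e0|ud].
  have /nbhs_ballP[del /= del0 uds] := ud _ e0.
  exists del => // s /= t0s sd.
  have [->|st] := eqVneq s t.
    by rewrite !subrr of_real0 scale0r subr0 rnorm0 normr0 mulr0.
  have := uds (s - t); rewrite /ball/= sub0r normrN => /(_ sd).
  rewrite subr_eq0 st (addrC t (s - t)) subrK => /(_ isT t0s).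
  have := quot (s - t); rewrite subr_eq0 => /(_ st); rewrite (addrC t (s - t)) subrK => ->.
  by rewrite ltr_pdivrMr ?normr_gt0 ?subr_eq0// => /ltW.
apply/cvg_rnormP => e e0.
have [|del del0 uds] := ud (e / 2); first by rewrite divr_gt0.
apply/nbhs_ballP; exists del => //= h; rewrite /ball/= sub0r normrN => hd h0 t0h.
rewrite quot// ltr_pdivrMr ?normr_gt0//.
have := uds (t + h) t0h; rewrite [t + h - t]addrC addKr => /(_ hd).
move=> /le_lt_trans; apply; rewrite ltr_pM2r ?normr_gt0//; lra.
Qed.

Lemma solution_onP f t0 (T : \bar R) v u :
  solution_on f t0 T v u <-> u t0 = v /\
   forall t, t0 <= t -> (t%:E < T)%E -> has_deriv [set s | t0 <= s] u t (f t (u t)).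
Proof.
by split=> -[u0 ud]; split=> // t t0t tT; apply/diff_quotient_cvgP; exact: ud.
Qed.

Lemma within_continuous_curve (g : H -> R) a b u :
  (forall x : H, forall e, 0 < e -> exists2 del, 0 < del &
     forall y, rnorm (y - x) < del -> `|g y - g x| < e) ->
  (forall t, a <= t <= b -> cont_at [set s | a <= s <= b] u t) ->
  {within `[a, b], continuous (g \o u)}.
Proof.
move=> cg cu; apply: within_continuous_dist => t tab e /(cg (u t))[del del0 gd].
by have [del1 del10 ud] := cu _ tab _ del0; exists del1 => // s sab st; apply/gd/ud.
Qed.

Section Inner.
Variable dot : {dot H for @scalar_conj R k}.
Hypothesis hH : induces_norm dot.

Lemma is_derive_inner u t d v : has_deriv setT u t d ->
  is_derive t (1 : R) (fun s => inner dot (u s) v) (inner dot d v).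
Proof.
move=> ud; apply: is_derive_dist => e e0.
have v0 : 0 < 1 + rnorm v by rewrite ltr_pwDl// rnorm_ge0.
have [|del del0 uds] := ud (e / (1 + rnorm v)); first by rewrite divr_gt0.
exists del => // s /(uds s I) us.
rewrite -innerBl -innerZl -innerBl (le_trans (normr_inner_le hH _ _))//.
rewrite (le_trans (ler_wpM2r (rnorm_ge0 _) us))// mulrAC ler_wpM2r//.
rewrite mulrAC ler_pdivrMr// ler_wpM2l ?(ltW e0)//; lra.
Qed.

(** Expanding |u t + delta|^2 with delta = u s - u t, the first-order part is
    2 (u t, delta); the term |delta|^2 is of second order since u is Lipschitz
    at t. *)
Lemma is_derive_rnorm2 u t d : has_deriv setT u t d ->
  is_derive t (1 : R) (fun s => rnorm (u s) ^+ 2) (2 * inner dot (u t) d).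
Proof.
move=> ud; apply: is_derive_dist => e e0.
have [del1 del10 ulip] := has_deriv_lipschitz ud.
(* C bounds the second-order term; U is the factor in front of the remainder,
   increased by 1 to make it positive. *)
set C := (1 + rnorm d) ^+ 2.
have C0 : 0 < C by rewrite exprn_gt0// ltr_pwDl// rnorm_ge0.
set U := 1 + 2 * rnorm (u t).
have U0 : 0 < U by rewrite ltr_pwDl// mulr_ge0// rnorm_ge0.
have [|del del0 uds] := ud (e / 2 / U); first by rewrite !divr_gt0.
exists (Num.min (Num.min del del1) (e / 2 / C)).
  by rewrite !lt_min del0 del10 !divr_gt0.
move=> s; rewrite !lt_min => /andP[/andP[sd sd1] sC].
have := uds s I sd; set rho := u s - u t - _ => hrho.
have := ulip s I sd1; set del' := u s - u t => hdel.
have us : u s = u t + del' by rewrite /del' addrC subrK.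
have rhoE : rho = del' - (s - t) *r: d by [].
clearbody rho del'.
have -> : rnorm (u s) ^+ 2 - rnorm (u t) ^+ 2 - (s - t) * (2 * inner dot (u t) d)
  = 2 * inner dot (u t) rho + rnorm del' ^+ 2.
  rewrite -!(inner_rnorm hH) us innerDl !innerDr (innerC dot del').
  rewrite rhoE innerBr innerZr; ring.
rewrite (le_trans (ler_normD _ _))//.
have -> : e * `|s - t| = e / 2 * `|s - t| + e / 2 * `|s - t| by field.
apply: lerD.
  rewrite normrM ger0_norm//.
  apply: (@le_trans _ _ (U * (e / 2 / U * `|s - t|))).
    rewrite (@le_trans _ _ (U * rnorm rho))//; last by rewrite ler_pM2l.
    rewrite (@le_trans _ _ (2 * (rnorm (u t) * rnorm rho)))//.
      by rewrite ler_pM2l// (normr_inner_le hH).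
    by rewrite mulrA ler_wpM2r ?rnorm_ge0// /U; lra.
  by rewrite mulrA mulrCA divff ?mulr1// gt_eqF.
rewrite ger0_norm ?sqr_ge0// (@le_trans _ _ (C * `|s - t| ^+ 2))//.
  by rewrite -exprMn ler_pXn2r ?nnegrE ?rnorm_ge0// mulr_ge0// addr_ge0// rnorm_ge0.
rewrite expr2 mulrA ler_wpM2r// mulrC -ler_pdivlMr//; exact: ltW.
Qed.

(** There is no mean value equality for vector-valued curves. Pairing the curve
    t |-> u t - t d with the constant vector v = u b - u a - (b - a) d yields a
    real function with increment |v|^2, to which the scalar theorem applies;
    Cauchy-Schwarz then bounds |v|^2 by C (b - a) |v|. *)
Lemma mean_value u (u' : R -> H) a b d C : a < b ->
  (forall t, a <= t <= b -> cont_at [set s | a <= s <= b] u t) ->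
  (forall t, a < t < b -> has_deriv setT u t (u' t)) ->
  (forall t, a < t < b -> rnorm (u' t - d) <= C) ->
  rnorm (u b - u a - (b - a) *r: d) <= C * (b - a).
Proof.
move=> ab cu du u'd; set v := u b - u a - _.
pose f s := inner dot (u s) v - s * inner dot d v.
have fd t : t \in `]a, b[%R -> is_derive t (1 : R) f (inner dot (u' t - d) v).
  rewrite in_itv/= => tab; have := is_derive_inner v (du _ tab) => fd.
  rewrite /f; apply: is_derive_eq; rewrite innerBl/= /GRing.scale/=; ring.
have cf : {within `[a, b], continuous f}.
  apply/subspace_continuousP => t tab; apply: cvgB; last first.
    by apply: cvg_within_filter; apply: cvgMl; exact: cvg_id.
  apply: (_ : {within `[a, b], continuous ((inner dot)^~ v \o u)} -> _).
    by move=> /subspace_continuousP; exact.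
  apply: within_continuous_curve cu => x e e0.
  have v0 : 0 < 1 + rnorm v by rewrite ltr_pwDl// rnorm_ge0.
  exists (e / (1 + rnorm v)) => [|y]; first by rewrite divr_gt0.
  rewrite ltr_pdivlMr// -innerBl => xy.
  apply: le_lt_trans (normr_inner_le hH _ _) (le_lt_trans _ xy).
  by rewrite ler_wpM2l ?rnorm_ge0//; lra.
have [c cab fab] := MVT ab fd cf.
have {fab} vv : rnorm v ^+ 2 = inner dot (u' c - d) v * (b - a).
  by rewrite -fab -(inner_rnorm hH) {1}/v !innerBl innerZl /f; ring.
move: cab; rewrite in_itv/= => /u'd u'C.
have [v0|v0] := eqVneq (rnorm v) 0.
  by rewrite v0 mulr_ge0// ?subr_ge0 ?(ltW ab)// (le_trans _ u'C)// rnorm_ge0.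
have {}v0 : 0 < rnorm v by rewrite lt_neqAle eq_sym v0 rnorm_ge0.
rewrite -(ler_pM2r v0) -expr2 vv mulrAC ler_wpM2r ?subr_ge0 ?(ltW ab)//.
by rewrite (le_trans (inner_le hH _ _))// ler_wpM2r// ltW.
Qed.

End Inner.
End Curves.

(** * Comparison of norms with supersolutions *)

Section Comparison.
Variables (R : realType) (k : scalar_kind).
Variable H : completeNormedModType (scalar_field R k).
Variable dot : {dot H for @scalar_conj R k}.
Hypothesis hH : induces_norm dot.

(** Where |u| > phi >= 0 the norm is differentiable, with derivative
    (u, u') / |u| <= G(t, |u|), so (|u| - phi)' <= G(t, |u|) - G(t, phi) <=
    K (|u| - phi), where K is a one-sided Lipschitz constant of G up to the
    maximum of |u| on the interval. *)
Lemma rnorm_le_supersolution (u u' : R -> H) (G : R -> R -> R)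
    (phi phi' : R -> R) (a b : R) : a <= b ->
  (forall t, a <= t <= b -> cont_at [set s | a <= s <= b] u t) ->
  (forall t, a < t < b -> has_deriv setT u t (u' t)) ->
  (forall t, a < t < b ->
     inner dot (u t) (u' t) <= rnorm (u t) * G t (rnorm (u t))) ->
  {within `[a, b], continuous phi} ->
  (forall t, a < t < b ->
     [/\ 0 <= phi t, is_derive t (1 : R) phi (phi' t) & G t (phi t) <= phi' t]) ->
  (forall M, exists K, forall t g h, a < t < b -> 0 <= h -> h <= g -> g <= M ->
     G t g - G t h <= K * (g - h)) ->
  rnorm (u a) <= phi a -> rnorm (u b) <= phi b.
Proof.
move=> ab cu du uG cphi dphi Glip ua.
have cN : {within `[a, b], continuous (@rnorm R k H \o u)}.
  apply: within_continuous_curve cu => x e e0; exists e => // y.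
  exact: le_lt_trans (rnorm_dist _ _).
have [m mab maxm] := EVT_max ab cN.
have [K GK] := Glip (rnorm (u m)).
rewrite -subr_le0; pose f t := rnorm (u t) - phi t.
apply: (@le0_of_derive_le R f
  (fun t => inner dot (u t) (u' t) / rnorm (u t) - phi' t) a b K ab).
- apply/subspace_continuousP => t tab.
  by apply: cvgB; [have /subspace_continuousP := cN|have /subspace_continuousP := cphi]; apply.
- by rewrite subr_le0.
move=> t tab; rewrite {1}/f subr_gt0 => ft.
have [phi0 phid Gphi] := dphi _ tab.
have ut : 0 < rnorm (u t) by exact: le_lt_trans ft.
split.
  have -> : f = (fun s => Num.sqrt (rnorm (u s) ^+ 2) - phi s).
    by apply/funext => s; rewrite /f /= sqrtr_sqr ger0_norm ?rnorm_ge0.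
  have ud := is_derive_rnorm2 hH (du _ tab).
  have sd : is_derive (rnorm (u t) ^+ 2) (1 : R) Num.sqrt (2 * Num.sqrt (rnorm (u t) ^+ 2))^-1.
    by apply: is_derive1_sqrt; rewrite exprn_gt0.
  have cd := @is_derive1_comp R Num.sqrt (fun s => rnorm (u s) ^+ 2) t _ _ sd ud.
  apply: is_derive_eq; rewrite sqrtr_sqr ger0_norm ?rnorm_ge0// /GRing.scale/=.
  by field; rewrite gt_eqF.
have le_G : inner dot (u t) (u' t) / rnorm (u t) <= G t (rnorm (u t)).
  by rewrite ler_pdivrMr// mulrC uG.
have : G t (rnorm (u t)) - G t (phi t) <= K * (rnorm (u t) - phi t).
  apply: GK => //; first exact: ltW.
  by apply: maxm; rewrite in_itv/=; case/andP: tab => /ltW-> /ltW->.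
by apply: le_trans; exact: lerB.
Qed.

End Comparison.

Section Bound.
Variable R : realType.
Variables (r nu : R) (alpha : R -> R -> R) (beta : R -> R)
  (c0 p omega c1 lambda q : R).
Hypotheses (hc0 : 0 < c0) (hc1 : 0 < c1).
Hypothesis halpha_le : forall t g, 0 <= t -> 0 <= g -> alpha t g <= c0 * g `^ p.
Hypothesis hbeta_le : forall t, 0 <= t -> beta t <= c1 / (1 + t) `^ omega.
Hypotheses (hlambda : 0 < lambda) (hq : 0 < q)
  (hqp : nu <= q * (p - 1)) (homegaq : nu <= omega - q) (hnu : nu <= 1)
  (hsum : c0 / lambda `^ (p - 1) + c1 * lambda + q <= r).

(** With x = 1 + t >= 1, every term is compared with the single power
    x^(- q - nu): the damping term equals r / lambda times it, and each of the
    conditions q (p - 1) >= nu, omega - q >= nu, 1 >= nu bounds the power of x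
    in one of the other terms. *)
Lemma supersolution t : 0 <= t ->
  - gamma r nu t * (lambda^-1 * (1 + t) `^ (- q)) +
     alpha t (lambda^-1 * (1 + t) `^ (- q)) + beta t <=
  lambda^-1 * (- q * (1 + t) `^ (- q - 1)).
Proof.
move=> t0; set x := 1 + t; have x1 : 1 <= x by rewrite lerDl.
have x0 : 0 < x by exact: lt_le_trans x1.
have xn : x != 0 by rewrite gt_eqF.
have l0 : 0 < lambda^-1 by rewrite invr_gt0.
have mon e f : e <= f -> x `^ e <= x `^ f by exact: ler_powR.
have pD e f : x `^ (e + f) = x `^ e * x `^ f by rewrite powRD// xn implybT.
have y0 : 0 < lambda^-1 * x `^ (- q) by rewrite mulr_gt0// powR_gt0.
have ha := halpha_le t0 (ltW y0).
have hb := hbeta_le t0; rewrite -/x -powRN in hb.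
set c := x `^ (- q - nu).
have c_gt0 : 0 < c by exact: powR_gt0.
have ga : gamma r nu t * (lambda^-1 * x `^ (- q)) = r * lambda^-1 * c.
  by rewrite /gamma -/x -powRN /c pD; ring.
have lp : lambda^-1 `^ p = lambda^-1 / lambda `^ (p - 1).
  rewrite -powRN -(powR_inv1 (ltW hlambda)) -powRrM -powRD;
    last by rewrite (gt_eqF hlambda) implybT.
  by congr (_ `^ _); ring.
have {}ha : alpha t (lambda^-1 * x `^ (- q)) <= lambda^-1 * (c0 / lambda `^ (p - 1)) * c.
  apply: le_trans ha _; rewrite powRM ?(ltW l0) ?powR_ge0// lp -powRrM.
  have : x `^ (- q * p) <= c.
    by apply: mon; move: hqp; rewrite mulrBr mulr1 mulNr; lra.
  move=> /(ler_wpM2l (_ : 0 <= c0 * (lambda^-1 / lambda `^ (p - 1)))) => h.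
  rewrite mulrA (le_trans (h _))// ?mulr_ge0 ?invr_ge0 ?powR_ge0 ?(ltW hc0) ?(ltW hlambda)//.
  by rewrite le_eqVlt; apply/orP; left; apply/eqP; ring.
have {}hb : beta t <= lambda^-1 * (c1 * lambda) * c.
  apply: le_trans hb _; rewrite mulrCA mulVf ?gt_eqF// mulr1 ler_pM2l// mon//.
  by move: homegaq; lra.
have hq' : lambda^-1 * q * x `^ (- q - 1) <= lambda^-1 * q * c.
  by rewrite ler_pM2l ?mulr_gt0// mon//; move: hnu; lra.
rewrite mulNr ga.
have : (c0 / lambda `^ (p - 1) + c1 * lambda + q) * (lambda^-1 * c) <= r * (lambda^-1 * c).
  by rewrite ler_pM2r// mulr_gt0.
move: ha hb hq'; set X := alpha _ _; set Y := c0 / _; set Z := x `^ _.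
nra.
Qed.

End Bound.

(** * Continuation of solutions *)

Section Continuation.
Variables (R : realType) (k : scalar_kind).
Variable H : completeNormedModType (scalar_field R k).
Implicit Types (f : R -> H -> H) (u w : R -> H) (v : H).

Definition extends (T T' : \bar R) u w :=
  (T <= T')%E /\ forall t : R, 0 <= t -> (t%:E < T)%E -> w t = u t.

(** Zorn's lemma on the solutions that extend u. The members of a chain agree
    where they are both alive, so they have a union, which is a solution because
    being one is a local property. A maximal element of finite lifetime could be
    continued further by the second hypothesis. *)
Lemma solution_global f v (T : \bar R) u : (0 < T)%E ->
  (forall (T1 : R) w, solution_on f 0 T1%:E v w -> 0 < T1 ->
     exists2 T2 : R, T1 < T2 &
       exists2 w', solution_on f 0 T2%:E v w' & extends T1%:E T2%:E w w') ->
  solution_on f 0 T v u ->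
  exists2 w, solution_on f 0 +oo%E v w & extends T +oo%E u w.
Proof.
move=> T0 step su.
pose E := {p : \bar R * (R -> H) | solution_on f 0 p.1 v p.2 /\ extends T p.1 u p.2}.
pose le (p p' : E) := extends (sval p).1 (sval p').1 (sval p).2 (sval p').2.
have leE_refl p : le p p by split.
have leE_trans p2 p1 p3 : le p1 p2 -> le p2 p3 -> le p1 p3.
  move=> [T12 u12] [T23 u23]; split; first exact: le_trans T23.
  by move=> t t0 tT; rewrite u23 ?u12// (lt_le_trans tT).
have suE : solution_on f 0 T v u /\ extends T T u u by split.
have [|||[[T1 w] /= [sw uw]] max] :=
    @ZL_preorder E (exist _ (T, u) suE) (fun p p' => `[< le p p' >]).
- by move=> p; exact/asboolP.
- by move=> p1 p2 p3 /asboolP h12 /asboolP h23; apply/asboolP; exact: leE_trans h12 h23.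
(* The empty chain is bounded by u itself. *)
- move=> A chainA; have [[p0 Ap0]|A0] := pselect (A !=set0); last first.
    by exists (exist _ (T, u) suE) => p Ap; case: A0; exists p.
  pose Ts := ereal_sup [set (sval p).1 | p in A].
  pose w t := if pselect (exists2 p, A p & (t%:E < (sval p).1)%E) is left h
              then (sval (s2val (cid2 h))).2 t else v.
  have wE p t : A p -> 0 <= t -> (t%:E < (sval p).1)%E -> w t = (sval p).2 t.
    move=> Ap t0 tp; rewrite /w; case: pselect => [h|[]]; last by exists p.
    case: (cid2 h) => p' Ap' tp' /=.
    by have [/asboolP[_ ->]|/asboolP[_ <-]] := chainA _ _ Ap Ap'.
  have AT p : A p -> (T <= (sval p).1)%E by move: p => [p [? []]].
  have Tsup p : A p -> ((sval p).1 <= Ts)%E.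
    by move=> Ap; apply: ereal_sup_ubound; exists p.
  have sw : solution_on f 0 Ts v w.
    apply/solution_onP; split.
      rewrite (wE p0)//; last exact: lt_le_trans (AT _ Ap0).
      by case: p0 {Ap0} => [p [[]]].
    move=> t t0 /ereal_sup_gt[_ [p Ap <-] tp].
    rewrite (wE p)//.
    have [sp _] := svalP p; have [_ /(_ t t0 tp)] := (solution_onP _ _ _ _ _).1 sp.
    have [del del0 tdel] : exists2 del, 0 < del &
        forall s, `|s - t| < del -> (s%:E < (sval p).1)%E.
      move: tp; case: (sval p).1 => [r| |]//; last by exists 1 => // s; rewrite ltry.
      rewrite lte_fin => tr; exists (r - t) => [|s]; first by rewrite subr_gt0.
      by rewrite ltr_norml ltrD2r lte_fin => /andP[].
    apply: (has_deriv_near del0); first exact: wE.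
    by move=> s /= s0 /tdel sp'; split=> //; exact: wE.
  have uw : extends T Ts u w.
    split; first by rewrite (le_trans _ (Tsup _ Ap0))// AT.
    move=> t t0 tT; rewrite (wE p0)//; last exact: lt_le_trans (AT _ Ap0).
    by have [_ [_ ->]] := svalP p0.
  exists (exist _ (Ts, w) (conj sw uw)) => p Ap; apply/asboolP; split.
    exact: Tsup.
  by move=> t t0 tp; rewrite /= (wE p).
have [TT1 uwT] := uw; case T1E : T1 => [r| |].
- have swr : solution_on f 0 r%:E v w by rewrite -T1E.
  have r0 : 0 < r by rewrite -lte_fin -T1E (lt_le_trans T0).
  have [T2 rT2 [w' sw' [ww' ww]]] := step _ _ swr r0.
  have uw' : extends T T2%:E u w'.
    split; first by rewrite (le_trans TT1)// T1E.
    by move=> t t0 tT; rewrite ww ?uwT// -T1E (lt_le_trans tT).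
  have : le (exist _ (T1, w) (conj sw uw)) (exist _ (T2%:E, w') (conj sw' uw')).
    by split; rewrite /= T1E.
  move=> /asboolP/max/asboolP[/=].
  by rewrite T1E lee_fin leNgt rT2.
- by exists w; [rewrite -T1E|rewrite -T1E].
- by have := lt_le_trans T0 TT1; rewrite T1E.
Qed.

Lemma nbhs_rnorm v (B : set H) : nbhs v B ->
  exists2 del : R, 0 < del & forall y, rnorm (y - v) < del -> B y.
Proof.
move=> /nbhs_ballP[e /= e0 eB]; exists (re e) => [|y yv].
  by rewrite -(ltr_of_real k) of_real0 -(ge0_of_real (ltW e0)).
apply: eB; rewrite -ball_normE /= (ge0_of_real (ltW e0)) lt_dist_rnorm.
by rewrite rdistC.
Qed.

Lemma joint_continuity f :
  {within [set x : R * H | 0 <= x.1], continuous (fun x => f x.1 x.2)} ->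
  forall (t : R) v e, 0 <= t -> 0 < e -> exists2 del, 0 < del &
    forall s x, 0 <= s -> `|s - t| < del -> rnorm (x - v) < del ->
      rnorm (f s x - f t v) < e.
Proof.
move=> /subspace_continuousP cf t v e t0 e0.
have /cvg_rnormP/(_ _ e0) := cf (t, v) t0.
rewrite near_withinE => -[[B C] /= [/nbhs_ballP[d1 /= d10 d1B] /nbhs_rnorm[d2 d20 d2C]] BC].
exists (Num.min d1 d2) => [|s x s0]; first by rewrite lt_min d10.
rewrite !lt_min => /andP[sd _] /andP[_ xd].
by apply: (BC (s, x)) => //; split; [apply: d1B; rewrite /ball/= distrC|exact: d2C].
Qed.

Section Hilbert.
Variable dot : {dot H for @scalar_conj R k}.
Hypothesis hH : induces_norm dot.

(** A bounded derivative makes u Lipschitz on ]a, b[, so the values u t form a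
    Cauchy filter as t tends to b from the left. *)
Lemma left_limit u (u' : R -> H) (a b C : R) : a < b ->
  (forall t, a < t < b -> has_deriv setT u t (u' t)) ->
  (forall t, a < t < b -> rnorm (u' t) <= C) ->
  exists v, forall e, 0 < e -> exists2 del, 0 < del &
    forall s, b - del < s < b -> rnorm (u s - v) < e.
Proof.
move=> ab du u'C.
have lip s t : a < s -> s < t -> t < b -> rnorm (u t - u s) <= C * (t - s).
  move=> as_ st tb.
  have ins x : s <= x <= t -> a < x < b.
    by move=> /andP[sx xt]; rewrite (lt_le_trans as_)// (le_lt_trans xt).
  have ins' x : s < x < t -> a < x < b by move=> /andP[/ltW sx /ltW xt]; rewrite ins// sx.
  have := @mean_value R k H dot hH u u' s t 0 C st _ _ _.
  rewrite scaler0 subr0; apply.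
  - move=> x /ins /du /has_deriv_cont; exact: cont_at_sub.
  - by move=> x /ins' /du.
  - by move=> x /ins' /u'C; rewrite subr0.
have C0 : 0 <= C.
  apply: le_trans (u'C ((a + b) / 2) _); first exact: rnorm_ge0.
  by rewrite midf_lt//=; have [] := midf_lt ab.
have cu : cauchy (u @ b^'-).
  apply: cauchy_exP => e e0.
  have re0 : 0 < re e by rewrite -(ltr_of_real k) of_real0 -(ge0_of_real (ltW e0)).
  have C1 : 0 < C + 1 by rewrite ltr_wpDl.
  (* Within re e / (C + 1) of b the Lipschitz bound C makes u vary by less than
     e; the midpoint keeps s to the right of a. *)
  pose s := Num.max ((a + b) / 2) (b - re e / (C + 1)).
  have as_ : a < s by rewrite lt_max midf_lt.
  have sb : s < b by rewrite gt_max midf_lt//= gtrBl divr_gt0.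
  exists (u s); suff : \forall t \near b^'-, ball (u s) e (u t) by [].
  near=> t.
  have st : s < t by near: t; exact: nbhs_left_gt.
  have tb : t < b by near: t; exact: nbhs_left_lt.
  rewrite /= -ball_normE /= (ge0_of_real (ltW e0)) lt_dist_rnorm rdistC.
  apply: le_lt_trans (lip _ _ as_ st tb) _.
  have : t - s < re e / (C + 1).
    rewrite ltrBlDr -ltrBlDl; apply: (@lt_le_trans _ _ (b - re e / (C + 1))).
      by rewrite ltrD2r.
    by rewrite le_max lexx orbT.
  rewrite ltr_pdivlMr// => h; apply: le_lt_trans h.
  by rewrite mulrC ler_wpM2l// ?subr_ge0 ?ltW// ltrDl.
have /cauchy_cvgP/cvg_ex[v uv] := cu.
exists v => e e0; have /cvg_rnormP/(_ _ e0) := uv.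
move=> /nbhs_ballP[del /= del0 ud]; exists del => // s /andP[bs sb].
by apply: ud => //; rewrite /ball/= ger0_norm ?subr_ge0 ?(ltW sb)// ltrBlDr -ltrBlDl.
Unshelve. all: by end_near. Qed.

(** Only the derivative at T from the left is not immediate. By the mean value
    inequality on [s, T], the glued curve deviates from its tangent f(T, v) by at
    most (T - s) times the oscillation of t |-> f(t, u t) near T, and this is
    small because u t tends to v and f is jointly continuous. *)
Lemma glue_solutions f (T T' : R) v0 v u z : 0 < T ->
  {within [set x : R * H | 0 <= x.1], continuous (fun x => f x.1 x.2)} ->
  solution_on f 0 T%:E v0 u -> solution_on f T T'%:E v z ->
  (forall e, 0 < e -> exists2 del, 0 < del &
    forall s, T - del < s < T -> rnorm (u s - v) < e) ->
  solution_on f 0 T'%:E v0 (fun t => if t < T then u t else z t).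
Proof.
move=> T0 cf /solution_onP[u0 du] /solution_onP[zT dz] uv.
set w := fun t => _; have wT : w T = v by rewrite /w ltxx.
have wu t : t < T -> w t = u t by rewrite /w => ->.
have wz t : T <= t -> w t = z t by rewrite /w ltNge => ->.
have dwu t : 0 <= t -> t < T -> has_deriv [set s | 0 <= s] w t (f t (w t)).
  move=> t0 tT; rewrite (wu _ tT); move: (tT); rewrite -subr_gt0 => tT'.
  apply: (has_deriv_near tT' (wu _ tT) _ (du _ t0 _)); last by rewrite lte_fin.
  by move=> s s0; rewrite ltr_norml ltrD2r => /andP[_ sT]; rewrite wu.
have left e : 0 < e -> exists2 del, 0 < del & forall s, 0 <= s -> T - del < s < T ->
    rnorm (w s - w T - (s - T) *r: f T v) <= e * `|s - T|.
  move=> e0; have [d1 d10 fd] := joint_continuity cf v (ltW T0) e0.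
  have [d2 d20 ud] := uv _ d10.
  exists (Num.min d1 d2) => [|s s0 /andP[sd sT]]; first by rewrite lt_min d10.
  have near_T t : s <= t -> t < T -> T - d1 < t < T /\ T - d2 < t < T.
    move=> st tT; rewrite !tT !andbT.
    have dT := lt_le_trans sd st.
    by split; apply: le_lt_trans dT; rewrite lerD2l lerN2 ge_min lexx ?orbT.
  have -> : w s - w T - (s - T) *r: f T v = - (w T - w s - (T - s) *r: f T v).
    by rewrite -(opprB T s) of_realN scaleNr opprK !opprB addrC.
  rewrite rnormN distrC ger0_norm ?subr_ge0 ?(ltW sT)//.
  apply: (@mean_value R k H dot hH w (fun t => f t (w t))) => //.
  - move=> t /andP[st]; rewrite le_eqVlt => /predU1P[->|tT].
      move=> e' e'0; have [d3 d30 ud3] := uv _ e'0; exists d3 => // x /andP[_].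
      rewrite wT le_eqVlt => /predU1P[->|xT]; first by rewrite wT (subrr v) rnorm0.
      rewrite distrC ger0_norm ?subr_ge0 ?(ltW xT)// ltrBlDr -ltrBlDl wu// => ?.
      by apply: ud3; rewrite xT andbT.
    apply: cont_at_sub (has_deriv_cont (dwu t _ tT)); last exact: le_trans st.
    by move=> x /= /andP[sx _]; exact: le_trans sx.
  - move=> t /andP[st tT]; have t0 : 0 < t by exact: le_lt_trans st.
    exact: (has_deriv_interior t0 (dwu _ (ltW t0) tT)).
  - move=> t /andP[st tT]; have [t1 t2] := near_T t (ltW st) tT.
    apply/ltW/fd; first by rewrite (le_trans s0)// ltW.
      rewrite distrC ger0_norm ?subr_ge0 ?(ltW tT)// ltrBlDr -ltrBlDl.
      by case/andP: t1.
    by rewrite wu// ud.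
apply/solution_onP; split; first by rewrite wu.
move=> t t0 tT'; have [tT|Tt|tT] := ltgtP t T; first exact: dwu.
- rewrite (wz _ (ltW Tt)).
  have := dz t (ltW Tt) tT'; apply: (has_deriv_near (_ : 0 < t - T)).
  + by rewrite subr_gt0.
  + by rewrite wz// ltW.
  move=> s _; rewrite ltr_norml opprB ltrD2r => /andP[Ts _].
  by split; [exact: ltW|rewrite wz// ltW].
rewrite tT in tT' *; move=> e e0; have [d1 d10 ld] := left _ e0.
have [|d2 d20 rd] := dz T (lexx _) _ e e0; first exact: tT'.
exists (Num.min d1 d2) => [|s /= s0]; first by rewrite lt_min d10.
rewrite lt_min => /andP[sd1 sd2]; rewrite wT.
have [Ts|sT] := leP T s; first by rewrite (wz _ Ts) -zT rd.
by move: (ld s s0); rewrite wT; apply; rewrite sT andbT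
  ltrBlDr -ltrBlDl -[T - s]ger0_norm ?subr_ge0 1?ltW// distrC.
Qed.

End Hilbert.
End Continuation.

(** * The evolution problem *)

Section Problem.
Variables (R : realType) (k : scalar_kind).
Variables (H : completeNormedModType (scalar_field R k))
  (dot : {dot H for @scalar_conj R k}).
Variables (A : R -> {linear H -> H}) (F : R -> H -> H) (b : R -> H) (u0 : H).
Variables (r nu : R) (alpha : R -> R -> R) (beta : R -> R)
  (c0 p omega c1 lambda q : R).
Hypotheses (hH : induces_norm dot) (hr : 0 < r).
Hypothesis hAdiss : forall t : R, 0 <= t -> forall u : H,
  re (dot (A t u) u) <= - gamma r nu t * rnorm u ^+ 2.
Hypothesis hF : forall t : R, 0 <= t -> forall u : H, rnorm (F t u) <= alpha t (rnorm u).
Hypothesis hb : forall t : R, 0 <= t -> rnorm (b t) <= beta t.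
Hypothesis halpha : admissible_alpha alpha.
Hypotheses (hc0 : 0 < c0) (hp : 1 < p) (homega : 0 < omega) (hc1 : 0 < c1).
Hypothesis halpha_le : forall t g : R, 0 <= t -> 0 <= g -> alpha t g <= c0 * g `^ p.
Hypothesis hbeta_le : forall t : R, 0 <= t -> beta t <= c1 / (1 + t) `^ omega.
Hypotheses (hlambda : 0 < lambda) (hq : 0 < q).

Let f := rhs A F b.

(** The energy inequality: dissipativity handles the linear part and
    Cauchy-Schwarz the rest. *)
Lemma inner_rhs t u : 0 <= t ->
  inner dot u (f t u) <=
  rnorm u * (- gamma r nu t * rnorm u + alpha t (rnorm u) + beta t).
Proof.
move=> t0; rewrite innerC /f /rhs !innerDl 2!mulrDr.
have hA : inner dot (A t u) u <= rnorm u * (- gamma r nu t * rnorm u).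
  by apply: le_trans (hAdiss t0 u) _; rewrite expr2 [leRHS]mulrC mulrA.
rewrite !lerD// (le_trans (inner_le hH _ _))// mulrC ler_wpM2l ?rnorm_ge0//.
  exact: hF.
exact: hb.
Qed.

(** The damping term contributes -gamma (g - h) <= 0, so a Lipschitz constant of
    alpha up to a positive radius above M suffices. *)
Lemma growth_lipschitz a M : exists K, forall t g h, 0 < t < a -> 0 <= h -> h <= g ->
  g <= M -> (- gamma r nu t * g + alpha t g + beta t) -
            (- gamma r nu t * h + alpha t h + beta t) <= K * (g - h).
Proof.
have [_ _ _ lip] := halpha.
have [|K [K0 aK]] := lip a (`|M| + 1); first by rewrite ltr_wpDl.
exists K => t g h /andP[t0 ta] h0 hg gM.
have gM1 : g <= `|M| + 1.
  by rewrite (le_trans gM)// (le_trans (ler_norm M))// lerDl.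
have : `|alpha t g - alpha t h| <= K * `|g - h|.
  apply: aK; first by rewrite !ltW.
    by rewrite gM1 (le_trans h0).
  by rewrite h0 (le_trans hg).
rewrite [`|g - h|]ger0_norm ?subr_ge0//; apply: le_trans.
apply: le_trans (ler_norm _).
have : 0 <= gamma r nu t * (g - h).
  by rewrite mulr_ge0 ?subr_ge0// /gamma divr_ge0 ?powR_ge0// ltW.
by rewrite mulrBr; lra.
Qed.

Hypotheses (hqp : nu <= q * (p - 1)) (homegaq : nu <= omega - q) (hnu : nu <= 1)
  (hsum : c0 / lambda `^ (p - 1) + c1 * lambda + q <= r)
  (hu0 : rnorm u0 < 1 / lambda).

Lemma solution_bound (T : \bar R) u : solution_on f 0 T u0 u ->
  forall t : R, 0 <= t -> (t%:E < T)%E -> rnorm (u t) <= 1 / (lambda * (1 + t) `^ q).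
Proof.
move=> /solution_onP[u00 du] t t0 tT.
pose phi (s : R) := lambda^-1 * (1 + s) `^ (- q).
have -> : 1 / (lambda * (1 + t) `^ q) = phi t.
  by rewrite /phi powRN div1r invfM.
have dphi (s : R) : 0 <= s -> is_derive s (1 : R) phi (lambda^-1 * (- q * (1 + s) `^ (- q - 1))).
  move=> s0; have s1 : 0 < 1 + s by rewrite ltr_pwDl.
  have d1 : is_derive s (1 : R) (fun x : R => 1 + x) 1.
    rewrite -[X in is_derive _ _ _ X](add0r 1).
    exact: (is_deriveD (is_derive_cst _ _ _) (is_derive_id _ _)).
  have d2 := @is_derive1_comp R (@powR R ^~ (- q)) (fun x : R => 1 + x) s _ _
    (@is_derive1_powR R (- q) (1 + s) s1) d1.
  have d3 : is_derive s (1 : R) (lambda^-1 *: ((@powR R ^~ (- q)) \o (fun x : R => 1 + x)))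
      (lambda^-1 *: (- q * (1 + s) `^ (- q - 1) * 1)) by exact: is_deriveZ.
  by rewrite mulr1 in d3.
apply: (@rnorm_le_supersolution R k H dot hH u (fun s => f s (u s))
  (fun s g => - gamma r nu s * g + alpha s g + beta s) phi
  (fun s => lambda^-1 * (- q * (1 + s) `^ (- q - 1))) 0 t t0).
- move=> s /andP[s0 st]; apply: cont_at_sub (has_deriv_cont (du s s0 _)).
    by move=> x /= /andP[].
  by rewrite (le_lt_trans _ tT)// lee_fin.
- move=> s /andP[s0 st]; apply: (has_deriv_interior s0); apply: du; first exact: ltW.
  by rewrite (lt_trans _ tT)// lte_fin.
- by move=> s /andP[s0 _]; apply: inner_rhs; exact: ltW.
- apply/subspace_continuousP => s /=; rewrite in_itv/= => /andP[s0 _].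
  apply: cvg_within_filter; apply: differentiable_continuous.
  by apply/derivable1_diffP; have [] := dphi s s0.
- move=> s /andP[/ltW s0 _]; split; [|exact: dphi|
    exact: (supersolution hc0 hc1 halpha_le hbeta_le hlambda hq hqp homegaq hnu hsum)].
  by rewrite mulr_ge0 ?powR_ge0// invr_ge0 ltW.
- exact: growth_lipschitz.
by rewrite u00 /phi addr0 powR1 mulr1 -div1r ltW.
Qed.

(** No control is assumed on how the norm of A t varies with t. A bound uniform in
    t near T comes from joint continuity at (T, 0): for t near T and |y| < del,
    A t y = f t y - F t y - b t is bounded, and any x with |x| <= rho is a
    multiple of such a y by a fixed factor. *)
Lemma rhs_locally_bounded (T rho : R) : 0 <= T -> 0 < rho ->
  {within [set x : R * H | 0 <= x.1], continuous (fun x => f x.1 x.2)} ->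
  exists2 del, 0 < del & exists C, forall t x, 0 <= t -> `|t - T| < del ->
    rnorm x <= rho -> rnorm (f t x) <= C.
Proof.
move=> T0 rho0 cf.
have [del del0 fd] := joint_continuity cf 0 T0 ltr01.
have Fb M t x : 0 <= t -> rnorm x <= M -> rnorm (F t x) + rnorm (b t) <= c0 * M `^ p + c1.
  move=> t0 xM; apply: lerD.
    apply: le_trans (hF t0 x) _; apply: le_trans (halpha_le t0 (rnorm_ge0 x)) _.
    rewrite ler_pM2l// ge0_ler_powR// ?nnegrE ?rnorm_ge0//; first exact: ltW (lt_trans ltr01 hp).
    exact: le_trans (rnorm_ge0 x) xM.
  apply: le_trans (hb t0) _; apply: le_trans (hbeta_le t0) _.
  rewrite ler_pdivrMr ?powR_gt0 ?ltr_pwDl// ler_peMr ?(ltW hc1)//.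
  rewrite -[leLHS](powRr0 (1 + t)) ler_powR ?(ltW homega)//.
  by rewrite lerDl.
(* Multiplication by m maps the ball of radius rho into that of radius
   del / 2. *)
pose m := del / 2 / rho; have m0 : 0 < m by rewrite !divr_gt0.
pose C := 1 + rnorm (f T 0) + (c0 * (del / 2) `^ p + c1).
exists del => //; exists (m^-1 * C + (c0 * rho `^ p + c1)) => t x t0 tT xrho.
set y := m *r: x.
have yd : rnorm y <= del / 2.
  rewrite /y rnormZ ger0_norm ?(ltW m0)// /m mulrAC ler_pdivrMr// ler_pM2l ?divr_gt0//.
have fy : rnorm (f t y) <= 1 + rnorm (f T 0).
  rewrite -(subrK (f T 0) (f t y)) (le_trans (rnormD _ _))// lerD2r ltW// fd// subr0.
  by rewrite (le_lt_trans yd)//; lra.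
have Ay : rnorm (A t y) <= C.
  have -> : A t y = f t y - (F t y + b t) by rewrite /f /rhs -(addrA (A t y)) addrK.
  apply: le_trans (rnormD _ _) _; rewrite rnormN lerD//.
  by apply: le_trans (rnormD _ _) _; exact: Fb.
have Ax : rnorm (A t x) <= m^-1 * C.
  have -> : x = m^-1 *r: y.
    by rewrite /y scalerA -of_realM mulVf ?gt_eqF// of_real1 scale1r.
  by rewrite linearZ rnormZ ger0_norm ?invr_ge0 ?(ltW m0)// ler_pM2l ?invr_gt0.
rewrite /f /rhs -addrA; apply: le_trans (rnormD _ _) _; rewrite lerD//.
by apply: le_trans (rnormD _ _) _; exact: Fb.
Qed.

(** The a priori bound keeps u in the ball of radius 1 / lambda up to T, where the
    right-hand side is bounded; u thus converges at T and can be restarted. *)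
Lemma solution_step (T : R) u : locally_solvable f ->
  solution_on f 0 T%:E u0 u -> 0 < T ->
  exists2 T2 : R, T < T2 &
    exists2 w, solution_on f 0 T2%:E u0 w & extends T%:E T2%:E u w.
Proof.
move=> [cf loc] su T0; have [_ du] := (solution_onP _ _ _ _ _).1 su.
have rho0 : 0 < 1 / lambda by rewrite divr_gt0.
have [del del0 [C fC]] := rhs_locally_bounded (ltW T0) rho0 cf.
have u_le t : 0 <= t -> t < T -> rnorm (u t) <= 1 / lambda.
  move=> t0 tT; apply: le_trans (solution_bound su t0 _) _; first by rewrite lte_fin.
  rewrite ler_pM2l// lef_pV2 ?posrE ?mulr_gt0// ?powR_gt0 ?ltr_pwDl//.
  by rewrite ler_peMr ?(ltW hlambda)// -[leLHS](powRr0 (1 + t)) ler_powR ?(ltW hq)// lerDl.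
have [|t /andP[at_ tT]|t /andP[at_ tT]|v uv] :=
  @left_limit R k H dot hH u (fun t => f t (u t)) (Num.max 0 (T - del)) T C.
- by rewrite gt_max T0 gtrBl.
- move: at_; rewrite gt_max => /andP[t0 _]; apply: (has_deriv_interior t0).
  by apply: du; [exact: ltW|rewrite lte_fin].
- move: at_; rewrite gt_max => /andP[t0 tdel]; apply: fC; first exact: ltW.
    by rewrite distrC ger0_norm ?subr_ge0 ?(ltW tT)// ltrBlDr -ltrBlDl.
  by rewrite u_le// ltW.
have [T2 [TT2 [z sz]]] := loc T v (ltW T0).
exists T2 => //; exists (fun t => if t < T then u t else z t).
  exact: glue_solutions hH _ _ _ _ _ _ _ T0 cf su sz uv.
split; first by rewrite lee_fin ltW.
by move=> t _; rewrite lte_fin => ->.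
Qed.

End Problem.

Theorem proposition2 (R : realType) (k : scalar_kind)
  (H : completeNormedModType (scalar_field R k)) (dot : {dot H for @scalar_conj R k})
  (A : R -> {linear H -> H}) (F : R -> H -> H) (b : R -> H) (u0 : H)
  (r nu : R) (alpha : R -> R -> R) (beta : R -> R)
  (c0 p omega c1 lambda q : R)
  (hH : induces_norm dot)
  (hr : 0 < r)
  (hA : forall t, 0 <= t -> bounded_operator (A t))
  (hAdiss : forall t, 0 <= t -> forall u : H,
    re (dot (A t u) u) <= - gamma r nu t * rnorm u ^+ 2)
  (hF : forall t, 0 <= t -> forall u : H, rnorm (F t u) <= alpha t (rnorm u))
  (hb : forall t, 0 <= t -> rnorm (b t) <= beta t)
  (halpha : admissible_alpha alpha)
  (hbeta : admissible_beta beta)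
  (hc0 : 0 < c0) (hp : 1 < p) (homega : 0 < omega) (hc1 : 0 < c1)
  (halpha_le : forall t g, 0 <= t -> 0 <= g -> alpha t g <= c0 * g `^ p)
  (hbeta_le : forall t, 0 <= t -> beta t <= c1 / (1 + t) `^ omega)
  (hlambda : 0 < lambda) (hq : 0 < q)
  (hqp : nu <= q * (p - 1)) (homegaq : nu <= omega - q) (hnu : nu <= 1)
  (hsum : c0 / lambda `^ (p - 1) + c1 * lambda + q <= r)
  (hu0 : rnorm u0 < 1 / lambda) :
  (* every solution, on any interval [0, T) with T <= +oo, obeys the bound *)
  (forall (T : \bar R) (u : R -> H),
    solution_on (rhs A F b) 0 T u0 u ->
    forall t, 0 <= t -> (t%:E < T)%E ->
      0 <= rnorm (u t) <= 1 / (lambda * (1 + t) `^ q)) /\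
  (* if the problem is locally solvable, then it has a solution on all of R_+,
     and every solution on some [0, T) extends to a solution on R_+ *)
  (locally_solvable (rhs A F b) ->
    (exists u : R -> H, solution_on (rhs A F b) 0 +oo%E u0 u) /\
    (forall (T : \bar R) (u : R -> H),
      solution_on (rhs A F b) 0 T u0 u ->
      exists w : R -> H, solution_on (rhs A F b) 0 +oo%E u0 w /\
        forall t, 0 <= t -> (t%:E < T)%E -> w t = u t)).
Proof.
split=> [T u su t t0 tT|solv].
  by rewrite rnorm_ge0 (solution_bound hH hr hAdiss hF hb halpha hc0 hc1 halpha_le
    hbeta_le hlambda hq hqp homegaq hnu hsum hu0 su).
have extend (T : \bar R) u : (0 < T)%E -> solution_on (rhs A F b) 0 T u0 u ->
    exists2 w, solution_on (rhs A F b) 0 +oo%E u0 w & extends T +oo%E u w.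
  move=> T0; apply: solution_global T0 _ => T1 w sw T1_gt0.
  exact: (solution_step hH hr hAdiss hF hb halpha hc0 hp homega hc1 halpha_le hbeta_le
    hlambda hq hqp homegaq hnu hsum hu0 solv).
have [T1 [T1_gt0 [u1 su1]]] := solv.2 0 u0 (lexx 0).
have [|w1 sw1 _] := extend T1%:E u1 _ su1; first by rewrite lte_fin.
split; first by exists w1.
move=> T u su; have [T0|T0] := ltP 0%E T.
  by have [w sw [_ wu]] := extend T u T0 su; exists w.
(* A lifetime T <= 0 imposes no agreement, so any global solution serves. *)
exists w1; split=> // t t0 tT.
by have := lt_le_trans tT T0; rewrite lte_fin ltNge t0.
Qed.
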